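(* Let $S$ be a semigroup which is a finite disjoint union of copies of the free monogenic semigroup, i.e. $S=\bigsqcup_{a\in A}N_a$ where $A$ is a finite set and each $N_a$ is a subsemigroup of $S$ isomorphic to the additive semigroup $\mathbb{N}=\{1,2,3,\dots\}$. Then $S$ is finitely presented and residually finite.
   Context: The free monogenic semigroup is the additive semigroup of positive integers $\mathbb{N}=\{1,2,3,\dots\}$ (written multiplicatively as $\{a,a^2,a^3,\dots\}$ with all powers distinct). No commutativity of $S$ is assumed. A semigroup $S$ is finitely presented if there are a finite set $X$ and a finite set $R\subseteq X^+\times X^+$ (where $X^+$ is the free semigroup on $X$) such that $S$ is isomorphic to the quotient of $X^+$ by the congruence generated by $R$. A semigroup $S$ is residually finite if for any two distinct $s,t\in S$ there is a homomorphism $\phi$ from $S$ into a finite semigroup with $\phi(s)\neq\phi(t)$. *)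

(* Defs.v *)
From HB Require Import structures.
From mathcomp Require Import all_boot.
From mathcomp Require Import boolp classical_sets functions.

Set Implicit Arguments.
Unset Strict Implicit.
Unset Printing Implicit Defensive.

Local Open Scope classical_set_scope.
Local Open Scope group_scope.
Local Open Scope quotient_scope.

(** The additive semigroup {1, 2, 3, ...}. Its operation is addition, written
    multiplicatively through the [semigroupType] interface. *)

Definition posnat : Type := {n : nat | (0 < n)%N}.

HB.instance Definition _ := SubChoice.on posnat.

Definition posnat_add (m n : posnat) : posnat :=
  exist (fun k => (0 < k)%N) (val m + val n)%N (ltn_addr (val n) (valP m)).

Lemma posnat_addA : associative posnat_add.
Proof. by move=> m n p; apply: val_inj; rewrite /= addnA. Qed.

HB.instance Definition _ := isSemigroup.Build posnat posnat_addA.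

Definition subsemigroup (S : semigroupType) (T : set S) : Prop :=
  forall x y, T x -> T y -> T (x * y).

(** For a subsemigroup [T] of [S], the map below is an isomorphism from
    [posnat] onto [T], presented as a homomorphism into the ambient [S]. *)
Definition free_monogenic (S : semigroupType) (T : set S) : Prop :=
  exists f : {multiplicative posnat -> S}, set_bij [set: posnat] T f.

Definition isomorphic (S T : semigroupType) : Prop :=
  exists f : {multiplicative S -> T}, bijective f.

(** The free semigroup X^+: nonempty words over [X] under concatenation. *)

Definition free_semigroup (X : choiceType) : Type := {w : seq X | w != [::]}.

HB.instance Definition _ (X : choiceType) := SubChoice.on (free_semigroup X).

Section FreeSemigroup.
Variable X : choiceType.

Fact word_cat_subproof (u v : free_semigroup X) : val u ++ val v != [::].
Proof. by case: u => [[|x u]]. Qed.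

Definition word_cat (u v : free_semigroup X) : free_semigroup X :=
  exist (fun w => w != [::]) (val u ++ val v) (word_cat_subproof u v).

Lemma word_catA : associative word_cat.
Proof. by move=> u v w; apply: val_inj; rewrite /= catA. Qed.

HB.instance Definition _ := isSemigroup.Build (free_semigroup X) word_catA.

End FreeSemigroup.

Definition congruence (S : semigroupType) (r : S -> S -> Prop) : Prop :=
  RelationClasses.Equivalence r /\
  forall x x' y y', r x x' -> r y y' -> r (x * y) (x' * y').

Section GeneratedCongruence.
Variables (S : semigroupType) (R : seq (S * S)).

(** The intersection of all congruences containing [R]. *)
Definition generated_congruence (x y : S) : Prop :=
  forall r, congruence r -> (forall p, p \in R -> r p.1 p.2) -> r x y.

Lemma generated_congruenceP : congruence generated_congruence.
Proof.
split; last first.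
  by move=> x x' y y' xx' yy' r cr Rr; apply: cr.2; [apply: xx' | apply: yy'].
split.
- by move=> x r [e _] _; apply: RelationClasses.Equivalence_Reflexive.
- move=> x y xy r cr Rr; have [e _] := cr.
  by apply: RelationClasses.Equivalence_Symmetric; apply: xy.
- move=> x y z xy yz r cr Rr; have [e _] := cr.
  by apply: (RelationClasses.Equivalence_Transitive x y z); [apply: xy | apply: yz].
Qed.

Definition generated_rel : rel S := fun x y => `[< generated_congruence x y >].

Fact generated_rel_equiv : equiv_class_of generated_rel.
Proof.
have [[r s t] _] := generated_congruenceP.
split.
- by move=> x; apply/asboolP.
- by move=> x y; apply/asboolP/asboolP; apply: s.
- by move=> y x z /asboolP xy /asboolP yz; apply/asboolP; apply: t xy yz.
Qed.

Canonical generated_equiv := EquivRelPack generated_rel_equiv.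

Definition semigroup_quotient : Type := {eq_quot generated_rel}.

HB.instance Definition _ := Choice.on semigroup_quotient.
HB.instance Definition _ := EqQuotient.on semigroup_quotient.

Definition quotient_mul : semigroup_quotient -> semigroup_quotient ->
    semigroup_quotient :=
  fun a b => \pi_semigroup_quotient (repr a * repr b).

Lemma quotient_mulE (x y : S) :
  quotient_mul (\pi_semigroup_quotient x) (\pi_semigroup_quotient y) =
  \pi_semigroup_quotient (x * y).
Proof.
have reprE z : generated_congruence (repr (\pi_semigroup_quotient z)) z.
  by apply/asboolP; rewrite -[`[< _ >]]/(generated_equiv _ _) -eqmodE reprK.
apply/eqP; rewrite eqmodE; apply/asboolP.
by apply: generated_congruenceP.2.
Qed.

Lemma quotient_mulA : associative quotient_mul.
Proof.
elim/quotW=> x; elim/quotW=> y; elim/quotW=> z.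
by rewrite (quotient_mulE y) (quotient_mulE x y) (quotient_mulE x) quotient_mulE mulgA.
Qed.

HB.instance Definition _ :=
  isSemigroup.Build semigroup_quotient quotient_mulA.

End GeneratedCongruence.

Definition finitely_presented (S : semigroupType) : Prop :=
  exists (X : finType) (R : seq (free_semigroup X * free_semigroup X)),
    isomorphic S (semigroup_quotient R).

#[short(type="finSemigroupType")]
HB.structure Definition FinSemigroup := {S of Semigroup S & Finite S}.

Definition residually_finite (S : semigroupType) : Prop :=
  forall s t : S, s <> t ->
  exists (F : finSemigroupType) (phi : {multiplicative S -> F}), phi s <> phi t.

(* Main.v *)
Require Import Defs.
From HB Require Import structures.
From mathcomp Require Import all_boot.
From mathcomp Require Import boolp classical_sets functions.
From mathcomp Require Import zify.

(** The argument takes place in the monoid [S^1], where every element other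
    than 1 is a unique positive power of a unique generator. The key fact is
    that [c ^+ r * u = c ^+ r'] forces [r <= r'], whatever [u] is.

    Finite presentability: the set of [i] with [a * b ^+ i] in the class of [c]
    is finite or, past some point, stable under a shift [i -> i + q]; there a
    single equation [c ^+ r * b ^+ q = c ^+ r'] passes from [a * b ^+ i] to
    [a * b ^+ (i + q)]. So finitely many relations rewrite every product of
    generators to a power of a generator.

    Residual finiteness: for fixed [s], the left congruence relating [u] and [v]
    when [x * u = s <-> x * v = s] for all [x] has finite index. Indeed, if
    [x * b ^+ i = s], two of the first [#|A| + 1] products [x * b ^+ p] lie in
    one class; either they are equal, and the sequence [x * b ^+ p] is
    periodic, or exponents grow along it, which bounds [i] in terms of [s] only.
    Hence [S] acts on a finite set, and this action separates [s] from every
    other element. *)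

Set Implicit Arguments.
Unset Strict Implicit.
Unset Printing Implicit Defensive.

Local Open Scope group_scope.
Local Open Scope quotient_scope.

(** * Uniform bounds, pigeonhole and shift-stable sets of exponents *)

Lemma finite_bound (T : finType) (P : T -> nat -> Prop) :
    (forall x m n, m <= n -> P x m -> P x n) -> (forall x, exists n, P x n) ->
  exists n, forall x, P x n.
Proof.
move=> Pmono /choice[f Pf]; exists (\max_x f x) => x.
by apply: Pmono (Pf x); apply: leq_bigmax.
Qed.

Lemma pigeonhole_nat (T : finType) (f : nat -> T) :
  exists p q, [/\ p < q, q <= #|T| & f p = f q].
Proof.
pose h (i : 'I_(#|T|.+1)) := f i.
have /injectivePn[x [y]] : ~~ injectiveb h.
  by apply/negP => /injectiveP/leq_card; rewrite card_ord ltnn.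
rewrite neq_ltn => /orP[] xy hxy.
  by exists x, y; split=> //; rewrite -ltnS.
by exists y, x; split=> //; rewrite -ltnS.
Qed.

(** In each residue class mod [q] that meets [I], any member [m] generates all [m + t * q], so [B]
    need only exceed one member per class. *)
Lemma shift_closed_bound (I : nat -> Prop) (q : nat) :
    0 < q -> (forall i, I i -> I (i + q)%N) ->
  exists B, forall i, I i -> B < i -> exists2 j, I j & i = (j + q)%N.
Proof.
move=> q0 Iq.
have Iqt t i : I i -> I (i + t * q)%N.
  by move=> Ii; elim: t => [|t IH]; rewrite ?addn0 // mulSn (addnC q) addnA; apply: Iq.
have [||B PB] := @finite_bound 'I_q
  (fun k B => forall i, I i -> i %% q = k -> B < i -> exists2 j, I j & i = (j + q)%N).
- by move=> k m n mn Pm i Ii ik ni; apply: Pm => //; apply: leq_ltn_trans ni.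
- move=> k; have [[m [Im mk]]|no] := pselect (exists m, I m /\ m %% q = k); last first.
    by exists 0 => i Ii ik; case: no; exists i.
  exists m => i Ii ik mi; exists (m + (i %/ q - m %/ q).-1 * q)%N; first exact: Iqt.
  move: mi; rewrite (divn_eq i q) (divn_eq m q) ik mk ltn_add2r ltn_mul2r => /andP[_ lt].
  rewrite !divnMDl // !(divn_small (ltn_ord k)) !addn0.
  nia.
by exists B => i Ii Bi; apply: (PB (Ordinal (ltn_pmod i q0))).
Qed.

Definition word_congruence (X : Type) (r : seq X -> seq X -> Prop) : Prop :=
  RelationClasses.Equivalence r /\
  forall u u' v v', r u u' -> r v v' -> r (u ++ v) (u' ++ v').

(** * The monoid obtained by adjoining an identity *)

Definition adjoin1 (S : semigroupType) : Type := option S.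

Section Adjoin1.
Variable S : semigroupType.

HB.instance Definition _ := Choice.on (adjoin1 S).

Definition adjoin1_mul (x y : adjoin1 S) : adjoin1 S :=
  match x, y with
  | Some s, Some t => Some (s * t)
  | Some _, None => x
  | None, _ => y
  end.

Lemma adjoin1_mulA : associative adjoin1_mul.
Proof. by move=> [x|] [y|] [z|] //=; rewrite mulgA. Qed.

Lemma adjoin1_mul1 : left_id None adjoin1_mul.
Proof. by []. Qed.

Lemma adjoin1_mulr1 : right_id None adjoin1_mul.
Proof. by case. Qed.

HB.instance Definition _ :=
  isMonoid.Build (adjoin1 S) adjoin1_mulA adjoin1_mul1 adjoin1_mulr1.

Lemma adjoin1_mul_eq1 (x y : adjoin1 S) : x * y = 1 -> x = 1.
Proof. by case: x y => [s|] [t|]. Qed.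

End Adjoin1.

(** * Criteria for residual finiteness and finite presentability *)

Definition transf (T : finType) : Type := {ffun T -> T}.

Section Transf.
Variable T : finType.

HB.instance Definition _ := Finite.on (transf T).

Definition transf_mul (f h : transf T) : transf T := [ffun t => f (h t)].

Lemma transf_mulA : associative transf_mul.
Proof. by move=> f g h; apply/ffunP => t; rewrite !ffunE. Qed.

HB.instance Definition _ := isSemigroup.Build (transf T) transf_mulA.

End Transf.

(* Only left translations occur, so this is merely a left congruence. *)
Definition left_syntactic (M : monoidType) (s u v : M) : Prop :=
  forall x : M, x * u = s <-> x * v = s.

Lemma left_syntactic_mul (M : monoidType) (s x u v : M) :
  left_syntactic s u v -> left_syntactic s (x * u) (x * v).
Proof. by move=> uv y; rewrite !mulgA. Qed.

(** [M] acts by left multiplication on the finitely many classes. If [s] and [t] act alike on the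
    class of 1, they are equivalent, and testing with [x = 1] gives [t = s]. *)
Lemma left_syntactic_finite (M : monoidType) (s : M) (T : finType)
    (rep : T -> M) :
    (forall u, exists t, left_syntactic s (rep t) u) ->
  exists phi : M -> transf T,
    {morph phi : x y / x * y} /\ forall t, phi s = phi t -> s = t.
Proof.
move=> repP; have [t0 _] := repP 1.
pose cl u := odflt t0 [pick t | `[< left_syntactic s (rep t) u >]].
have clP u : left_syntactic s (rep (cl u)) u.
  rewrite /cl; case: pickP => [t /asboolP //|no].
  by have [t /asboolP] := repP u; rewrite no.
have clE u v : left_syntactic s u v -> cl u = cl v.
  move=> uv; rewrite /cl; congr odflt; apply: eq_pick => t.
  by apply/asboolP/asboolP => tu y; rewrite tu uv.
exists (fun x => [ffun t => cl (x * rep t)]); split=> [x y|t /ffunP/(_ (cl 1))].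
  apply/ffunP => t; rewrite !ffunE -mulgA; apply: clE.
  by apply: left_syntactic_mul => z; rewrite clP.
have cl1 u : cl (u * rep (cl 1)) = cl u.
  by apply: clE => z; rewrite (left_syntactic_mul u (clP 1)) mulg1.
rewrite !ffunE !cl1 => st.
by have := clP t 1; rewrite -st (clP s 1) !mul1g => -[->].
Qed.

(** The isomorphism sends [x] to the class of an arbitrarily chosen word with value [x]; its inverse
    evaluates a representative. *)
Lemma finitely_presentedI (S : semigroupType) (X : finType)
    (R : seq (free_semigroup X * free_semigroup X))
    (e : free_semigroup X -> S) :
    (forall x, exists w, e w = x) -> {morph e : u v / u * v} ->
    (forall u v, generated_congruence R u v <-> e u = e v) ->
  finitely_presented S.
Proof.
move=> /choice[nf nfK] eM genE.
have piE u v : e u = e v ->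
    \pi_(semigroup_quotient R) u = \pi_(semigroup_quotient R) v.
  by move=> euv; apply/eqP; rewrite eqmodE; apply/asboolP/genE.
have e_repr w : e (repr (\pi_(semigroup_quotient R) w)) = e w.
  apply/genE/asboolP.
  by rewrite -[`[< _ >]]/(generated_equiv _ _ _) -eqmodE reprK.
pose f x := \pi_(semigroup_quotient R) (nf x).
have fM : {morph f : x y / x * y}.
  move=> x y; rewrite /f -[RHS]/(quotient_mul _ _) quotient_mulE.
  by apply: piE; rewrite eM !nfK.
pose phi : {multiplicative S -> semigroup_quotient R} :=
  HB.pack f (isMultiplicative.Build _ _ f fM).
exists X, R, phi.
exists (fun q => e (repr q)) => [x|q] /=; first by rewrite e_repr nfK.
by rewrite -[RHS]reprK; apply: piE; rewrite nfK.
Qed.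

(** * Exponents in a union of monogenic semigroups *)

Section MonogenicUnion.

Variables (M : monoidType) (A : finType) (g : A -> M).
Hypothesis mulg_eq1l : forall x y : M, x * y = 1 -> x = 1.
Hypothesis pow_ex : forall x : M, x <> 1 -> exists a i, 0 < i /\ x = g a ^+ i.
Hypothesis pow_inj : forall a b i j,
  0 < i -> g a ^+ i = g b ^+ j -> a = b /\ i = j.

Lemma mulg_eq1r (x y : M) : x * y = 1 -> y = 1.
Proof. by move=> xy; have x1 := mulg_eq1l xy; rewrite x1 mul1g in xy. Qed.

Lemma pow_inj1 a i j : g a ^+ i = g a ^+ j -> i = j.
Proof.
case: i => [|i] eq_ij; last by have [] := pow_inj (ltn0Sn i) eq_ij.
by case: j eq_ij => // j /esym eq_ij; have [] := pow_inj (ltn0Sn j) eq_ij.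
Qed.

Lemma pow_neq1 a i : 0 < i -> g a ^+ i <> 1.
Proof. by move=> i0; rewrite -(expg0 (g a)) => /pow_inj1 i_eq0; rewrite i_eq0 in i0. Qed.

Lemma expg_inj (y : M) i j : y <> 1 -> y ^+ i = y ^+ j -> i = j.
Proof.
move=> /pow_ex[a [k [k0 ->]]]; rewrite -!expgnA => /pow_inj1/eqP.
by rewrite eqn_mul2l eqn0Ngt k0 => /eqP.
Qed.

Lemma gen_function (f : nat -> M) : (forall t, f t <> 1) ->
  exists cl : nat -> A, forall t, exists i, f t = g (cl t) ^+ i.
Proof.
move=> f1; suff /choice[cl clE] : forall t, exists a, exists i, f t = g a ^+ i.
  by exists cl.
by move=> t; have [a [i [_ ->]]] := pow_ex (f1 t); exists a, i.
Qed.

(* If [c ^+ (r' + d) * u = c ^+ r'] with [d > 0], then [y = c ^+ d * u] fixes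
   [c ^+ r'] from the right, so all the [y ^+ t * c ^+ d] shift large powers of
   [c] by [d]; two of them in the same class therefore agree, and right
   multiplication by [u] makes [y] periodic. *)
Lemma leq_expg_mul (c : A) (u : M) r r' :
  g c ^+ r * u = g c ^+ r' -> r <= r'.
Proof.
move=> cu; rewrite leqNgt; apply/negP => lt_r'r.
pose d := (r - r')%N; have d0 : 0 < d by rewrite subn_gt0.
pose y := g c ^+ d * u.
have cy : g c ^+ r' * y = g c ^+ r' by rewrite mulgA -expgnDr subnKC // ltnW.
have y1 : y <> 1 by move/mulg_eq1l; apply: pow_neq1.
have cyt t : g c ^+ r' * y ^+ t = g c ^+ r'.
  by elim: t => [|t IH]; rewrite ?mulg1 // expgS mulgA cy.
pose x t := y ^+ t * g c ^+ d.
have cx t m : g c ^+ (m + r') * x t = g c ^+ (m + r' + d).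
  by rewrite expgnDr /x !mulgA -(mulgA (g c ^+ m)) cyt -expgnDr -expgnDr.
have [cl xE] : exists cl : nat -> A, forall t, exists i, x t = g (cl t) ^+ i.
  by apply: gen_function => t /mulg_eq1r; apply: pow_neq1.
have [p [q [lt_pq _ cl_pq]]] := pigeonhole_nat cl.
have [[i xp] [j xq]] := (xE p, xE q); rewrite -cl_pq in xq.
have iter t k : g c ^+ r' * x t ^+ k = g c ^+ (k * d + r').
  elim: k => [|k IH]; first by rewrite mulg1.
  by rewrite expgSr mulgA IH cx mulSn; congr (_ ^+ _); lia.
have ij : i = j.
  have : x p ^+ j = x q ^+ i by rewrite xp xq -!expgnA mulnC.
  move=> /(congr1 (fun z => g c ^+ r' * z)); rewrite !iter => /pow_inj1/eqP.
  by rewrite eqn_add2r eqn_pmul2r // => /eqP.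
have /(congr1 (fun z => z * u)) : x p = x q by rewrite xp xq ij.
rewrite /x -!mulgA -/y -!expgSr => /(expg_inj y1) [pq].
by rewrite pq ltnn in lt_pq.
Qed.

(** Factor out [g c ^+ (h - r)] on the left; [leq_expg_mul] ensures that [r' - r] is not
    truncated. *)
Lemma shift_expg (c : A) (u : M) r r' h :
  g c ^+ r * u = g c ^+ r' -> r <= h -> g c ^+ h * u = g c ^+ (h + (r' - r)).
Proof.
move=> cu rh; have rr' := leq_expg_mul cu.
by rewrite -{1}(subnK rh) expgnDr -mulgA cu -expgnDr; congr (_ ^+ _); lia.
Qed.

Lemma exponent_bound (x : M) : exists n, forall a i, x = g a ^+ i -> i <= n.
Proof.
have [->|x1] := pselect (x = 1).
  by exists 0 => a [] // i /esym/pow_neq1; case.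
have [b [j [j0 ->]]] := pow_ex x1.
by exists j => a i /(pow_inj j0)[_ ->].
Qed.

(** * Rewriting words to powers of generators *)

Local Notation ev w := (\prod_(x <- w) g x).

Lemma ev_nseq a i : ev (nseq i a) = g a ^+ i.
Proof. by elim: i => [|i IH]; rewrite ?big_nil // big_cons IH expgS. Qed.

Lemma ev_eq1 u : ev u = 1 -> u = [::].
Proof.
by case: u => // a u; rewrite big_cons => /mulg_eq1l/(@pow_neq1 a 1 isT).
Qed.

(** This stands for the finite set of defining relations: all true equations between words of length
    at most [B]. *)
Definition complete_upto (r : seq A -> seq A -> Prop) B := forall u v,
  size u <= B -> size v <= B -> ev u = ev v -> r u v.

Lemma descent_bound a b c : exists B, forall r, word_congruence r ->
  complete_upto r B -> forall i h, B < i -> g a * g b ^+ i = g c ^+ h ->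
  exists j k, [/\ 0 < j, j < i, g a * g b ^+ j = g c ^+ k &
    r (a :: nseq j b) (nseq k c) -> r (a :: nseq i b) (nseq h c)].
Proof.
pose I i := 0 < i /\ exists h, g a * g b ^+ i = g c ^+ h.
(* With at most one positive exponent in [I], a [B] beyond it makes the claim vacuous. *)
have [[i1 [i2 [lt_i12 [i1_gt0 [r1 E1]] [_ [r2 E2]]]]]|no2] :=
    pselect (exists i1 i2, [/\ i1 < i2, I i1 & I i2]); last first.
  have [[i0 Ii0]|no1] := pselect (exists i, I i).
    exists i0 => r _ _ i h lt_i0i E; case: no2; exists i0, i; split=> //.
    by split; [apply: leq_ltn_trans lt_i0i | exists h].
  exists 0 => r _ _ i h i_gt0 E; case: no1; exists i; split=> //; by exists h.
pose q := (i2 - i1)%N; have q_gt0 : 0 < q by rewrite subn_gt0.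
have Eq : g c ^+ r1 * g b ^+ q = g c ^+ r2.
  by rewrite -E1 -E2 -mulgA -expgnDr subnKC // ltnW.
have le_r12 := leq_expg_mul Eq.
have le_r1 i h : i1 <= i -> g a * g b ^+ i = g c ^+ h -> r1 <= h.
  move=> le_i1i E; apply: (@leq_expg_mul c (g b ^+ (i - i1))).
  by rewrite -E1 -mulgA -expgnDr subnKC.
have step i h : i1 <= i -> g a * g b ^+ i = g c ^+ h ->
    g a * g b ^+ (i + q) = g c ^+ (h + (r2 - r1)).
  move=> le_i1i E; rewrite expgnDr mulgA E.
  exact: shift_expg Eq (le_r1 _ _ le_i1i E).
(* Only exponents from [i1] on are kept: there [r1 <= h], so the equation [Eq] applies to
   [g c ^+ h]. *)
have [|B0 B0P] := @shift_closed_bound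
    (fun i => i1 <= i /\ exists h, g a * g b ^+ i = g c ^+ h) _ q_gt0.
  move=> i [le_i1i [h E]]; split; first exact: leq_trans (leq_addr _ _).
  by exists (h + (r2 - r1))%N; apply: step.
(* Large enough for [i] to be a shift of some [j >= i1], and for [Eq] to be among the short
   relations. *)
exists (B0 + i1 + q + r1 + r2)%N => r [[rr rs rt] rcat] rB i h lt_Bi E.
have [||j [le_i1j [k Ek]] ij] := B0P i; [split; [lia|by exists h]|lia|].
exists j, k; split=> //; [exact: leq_trans le_i1j|lia|move=> rjk].
have le_r1k := le_r1 _ _ le_i1j Ek.
have -> : h = (k - r1 + r2)%N.
  by apply: (@pow_inj1 c); rewrite -E ij (step _ _ le_i1j Ek); congr (_ ^+ _); lia.
(* The rewriting is [a b^j b^q], then [c^k b^q = c^(k-r1) c^r1 b^q], then [c^(k-r1) c^r2]. *)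
rewrite ij nseqD -cat_cons; apply: rt (rcat _ _ _ _ rjk (rr (nseq q b))) _.
rewrite -{1}(subnK le_r1k) !nseqD -catA; apply: rcat; first exact: rr.
by apply: rB; rewrite ?big_cat ?ev_nseq // ?size_cat !size_nseq; lia.
Qed.

Lemma letter_bound a b c : exists B, forall r, word_congruence r ->
  complete_upto r B -> forall i h, 0 < i -> g a * g b ^+ i = g c ^+ h ->
  r (a :: nseq i b) (nseq h c).
Proof.
have [B0 B0P] := descent_bound a b c.
have [|i|B1 B1P] := @finite_bound 'I_B0.+1
    (fun i n => forall h, g a * g b ^+ i = g c ^+ h -> h <= n).
- by move=> x m n le_mn Pm h /Pm /leq_trans; apply.
- have [n nP] := exponent_bound (g a * g b ^+ i).
  by exists n => h /nP.
(* Exponents [i <= B0] have [h <= B1], so both words are short, the successor counting the letter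
   [a]; larger [i] descend. *)
exists (B0 + B1).+1 => r rP rB.
have rB0 : complete_upto r B0 by move=> u v su sv; apply: rB; lia.
elim/ltn_ind => i IH h i_gt0 E; have [le_iB0|lt_B0i] := leqP i B0.
  have := B1P (Ordinal (le_iB0 : i < B0.+1)) h E => le_hB1.
  by apply: rB; rewrite ?big_cons ?ev_nseq //= size_nseq; lia.
have [j [k [j_gt0 lt_ji Ek]]] := B0P r rP rB0 i h lt_B0i E; apply.
exact: IH.
Qed.

Lemma complete_upto_bound : exists B, forall r, word_congruence r ->
  complete_upto r B -> forall u v, ev u = ev v -> r u v.
Proof.
have [||B BP] := @finite_bound (A * A * A)%type (fun x B => forall r,
    word_congruence r -> complete_upto r B -> forall i h, 0 < i ->
    g x.1.1 * g x.1.2 ^+ i = g x.2 ^+ h -> r (x.1.1 :: nseq i x.1.2) (nseq h x.2)).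
- move=> x m n le_mn Pm r rP rn; apply: Pm => // u v su sv.
  by apply: rn; apply: leq_trans le_mn.
- by move=> [[a b] c]; apply: letter_bound.
exists B => r rP rB; have [[rr rs rt] rcat] := rP.
(* Reduce the tail to a power first; [BP] then absorbs the leading letter. *)
have nf u : u <> [::] -> forall c h, ev u = g c ^+ h -> r u (nseq h c).
  elim: u => // a u IH _ c h; rewrite big_cons.
  have [->|u0] := pselect (u = [::]).
    by rewrite big_nil mulg1 => /(@pow_inj a c 1 h isT)[<- <-]; apply: rr.
  have [b [i [i_gt0 Eu]]] := pow_ex (fun E => u0 (ev_eq1 E)).
  rewrite Eu => E; apply: rt (BP (a, b, c) r rP rB i h i_gt0 E).
  by apply: (rcat [:: a] [:: a]); [apply: rr | apply: IH].
move=> u v Euv; have [u0|u0] := pselect (u = [::]).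
  by move: Euv; rewrite u0 big_nil => /esym/ev_eq1 ->; apply: rr.
have v0 : v <> [::] by move=> v0; move: Euv; rewrite v0 big_nil => /ev_eq1.
have [c [h [_ Eu]]] := pow_ex (fun E => u0 (ev_eq1 E)).
by apply: rt (nf u u0 c h Eu) _; apply/rs/nf; rewrite -?Euv.
Qed.

(** * Finite index of the left syntactic congruence *)

Lemma factor_period (s : M) (b : A) : exists K, forall i (x : M), K <= i ->
  x * g b ^+ i = s -> exists p q, [/\ 0 < q, q <= #|A|, p <= K &
    x * g b ^+ (p + q) = x * g b ^+ p].
Proof.
(* [W] bounds the exponents of [s * g b ^+ v] for all [v <= #|A|], independently of [x]. *)
have [||W WP] := @finite_bound 'I_(#|A|).+1
    (fun v n => forall d h, s * g b ^+ v = g d ^+ h -> h <= n).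
- by move=> x m n le_mn Pm d h /Pm /leq_trans; apply.
- by move=> v; apply: exponent_bound.
pose K := (#|A|.+1 + #|A| * W.+1)%N; exists K => i x le_Ki xs.
(* The exponent starts at 1 because [x] itself may be 1, which lies in no class. *)
have [t|cl clE] := @gen_function (fun t => x * g b ^+ t.+1).
  by move/mulg_eq1r; apply: pow_neq1.
have [p [p' [lt_pp' le_p' cl_pp']]] := pigeonhole_nat cl.
have [[r Er] [r' Er']] := (clE p, clE p'); rewrite -cl_pp' in Er'.
set d := cl p in Er Er'; pose q := (p' - p)%N.
have Eq : g d ^+ r * g b ^+ q = g d ^+ r'.
  by rewrite -Er -Er' -mulgA -expgnDr; congr (_ * _ ^+ _); rewrite /q; lia.
have le_rr' := leq_expg_mul Eq.
exists p.+1, q; split; [rewrite /q; lia | rewrite /q; lia | rewrite /K; lia |].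
have -> : (p.+1 + q = p'.+1)%N by rewrite /q; lia.
rewrite Er Er'; have [<- //|ne_rr'] := eqVneq r r'.
have iter t : x * g b ^+ (p.+1 + t * q) = g d ^+ (r + t * (r' - r)).
  elim: t => [|t IH]; first by rewrite !addn0.
  rewrite mulSn [(q + _)%N]addnC addnA expgnDr mulgA IH.
  by rewrite (shift_expg Eq (leq_addr _ _)); congr (_ ^+ _); lia.
have q_gt0 : 0 < q by rewrite /q; lia.
(* The first index [p.+1 + t * q] beyond [i] is [i + v] with [v <= #|A|]. The product there is
   [s * g b ^+ v], of exponent at least [t], so [t <= W], contradicting [K <= i]. *)
pose t := ((i - p.+1) %/ q).+1; pose v := (p.+1 + t * q - i)%N.
have divE := divn_eq (i - p.+1) q; have ltq := ltn_pmod (i - p.+1) q_gt0.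
have le_p1i : p < i by rewrite /K in le_Ki; lia.
have v_le : v < #|A|.+1 by rewrite /v /t /q in divE ltq *; lia.
have vE : (i + v = p.+1 + t * q)%N by rewrite /v /t; lia.
have := WP (Ordinal v_le) d (r + t * (r' - r))%N.
rewrite -xs -mulgA -expgnDr /= vE iter => /(_ erefl) le_W.
have le_tW : t <= W by move: ne_rr' le_rr' le_W; nia.
have le_q : q <= #|A| by rewrite /q; lia.
have : t * q <= W * #|A| by apply: leq_mul.
by rewrite /K in le_Ki; nia.
Qed.

Lemma factor_shift (s : M) : exists K, forall b i (x : M), K <= i ->
  x * g b ^+ i = s <-> x * g b ^+ (i + (#|A|)`!) = s.
Proof.
have [||K KP] := @finite_bound A (fun b K => forall i (x : M), K <= i ->
    x * g b ^+ i = s <-> x * g b ^+ (i + (#|A|)`!) = s).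
- by move=> b m n le_mn Pm i x le_ni; apply: Pm; apply: leq_trans le_ni.
- move=> b; have [K KP] := factor_period s b; exists K => i x le_Ki.
  suff per k : K <= k -> x * g b ^+ k = s ->
      x * g b ^+ (i + (#|A|)`!) = x * g b ^+ i.
    split=> [E|E]; first by rewrite (per i).
    by rewrite -(per (i + (#|A|)`!)%N) // (leq_trans le_Ki) ?leq_addr.
  move=> le_Kk /(KP _ _ le_Kk)[p [q [q_gt0 le_qA le_pK Ep]]].
  have iter t m : p <= m -> x * g b ^+ (m + t * q) = x * g b ^+ m.
    elim: t m => [|t IH] m le_pm; first by rewrite addn0.
    rewrite mulSn addnA IH ?(leq_trans le_pm) ?leq_addr //.
    rewrite -(subnKC le_pm) addnAC expgnDr mulgA Ep -mulgA -expgnDr //.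
  have /dvdnP[t ->] : q %| (#|A|)`! by apply: dvdn_fact; rewrite q_gt0.
  by apply: iter; apply: leq_trans le_Ki.
by exists K => b; apply: KP.
Qed.

Lemma left_syntactic_finite_index (s : M) :
  exists (T : finType) (rep : T -> M),
    forall u, exists t, left_syntactic s (rep t) u.
Proof.
have [K KP] := factor_shift s; pose n := (K + (#|A|)`!)%N.
exists (option (A * 'I_n)),
  (fun t => if t is Some (a, i) then g a ^+ (i : 'I_n) else 1) => u.
have [->|/pow_ex[a [i [_ ->]]]] := pselect (u = 1); first by exists None.
elim/ltn_ind: i => i IH; have [lt_in|le_ni] := ltnP i n.
  by exists (Some (a, Ordinal lt_in)).
have fact0 := fact_gt0 #|A|.
have [|t tP] := IH (i - (#|A|)`!)%N; first by rewrite /n in le_ni; lia.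
exists t => x; rewrite tP KP; last by rewrite /n in le_ni; lia.
by rewrite subnK //; rewrite /n in le_ni; lia.
Qed.

End MonogenicUnion.

(** * Transfer from the monoid back to the semigroup *)

Section SemigroupUnion.

Variables (S : semigroupType) (A : finType) (g : A -> adjoin1 S).
Hypothesis pow_ex : forall x : adjoin1 S,
  x <> 1 -> exists a i, 0 < i /\ x = g a ^+ i.
Hypothesis pow_inj : forall a b i j,
  0 < i -> g a ^+ i = g b ^+ j -> a = b /\ i = j.

Local Notation ev w := (\prod_(x <- w) g x).

Lemma union_residually_finite : residually_finite S.
Proof.
move=> s t st.
have [T [rep repP]] := left_syntactic_finite_index
  (@adjoin1_mul_eq1 S) pow_ex pow_inj (Some s : adjoin1 S).
have [phi [phiM phi_inj]] := left_syntactic_finite repP.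
pose f (x : S) := phi (Some x : adjoin1 S).
have fM : {morph f : x y / x * y} by move=> x y; rewrite /f -phiM.
pose psi : {multiplicative S -> transf T} :=
  HB.pack f (isMultiplicative.Build _ _ f fM).
exists (transf T), psi; by move=> /phi_inj[].
Qed.

Lemma union_finitely_presented : finitely_presented S.
Proof.
have [B BP] := complete_upto_bound (@adjoin1_mul_eq1 S) pow_ex pow_inj.
have /choice[e eE] (w : free_semigroup A) : exists x : S, ev (val w) = Some x.
  case E : (ev (val w)) => [x|]; first by exists x.
  by have := valP w; rewrite (ev_eq1 (@adjoin1_mul_eq1 S) pow_inj E).
have e_inj u v : ev (val u) = ev (val v) <-> e u = e v.
  by rewrite !eE; split=> [[]|->].
have eM : {morph e : u v / u * v}.
  move=> u v; apply: Some_inj.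
  by rewrite -eE big_cat /= !eE.
(* [insub] discards the empty word. *)
pose W : seq (free_semigroup A) :=
  pmap insub [seq val t | t <- enum {: B.-bseq A}].
have WP (w : free_semigroup A) : size (val w) <= B -> w \in W.
  move=> le_wB; rewrite mem_pmap_sub; apply/mapP.
  by exists (Bseq le_wB); rewrite ?mem_enum.
pose R := [seq p <- [seq (u, v) | u <- W, v <- W] | `[< e p.1 = e p.2 >]].
apply: (@finitely_presentedI S A R e) => // [x|u v].
  have [//|a [i [i_gt0 xE]]] := pow_ex (x := Some x).
  have ne : nseq i a != [::] by case: i i_gt0 {xE}.
  exists (Sub (nseq i a) ne); apply: Some_inj.
  by rewrite -eE SubK ev_nseq xE.
have [[gr gs gt] gM] := generated_congruenceP R.
split=> [uv|/e_inj uv].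
  apply: (uv (fun x y => e x = e y)) => [|p]; last first.
    by rewrite mem_filter => /andP[/asboolP].
  split=> [|x x' y y' xx' yy']; last by rewrite !eM xx' yy'.
  by split=> [x|x y ->|x y z -> ->].
(* The generated congruence is extended to all words, the empty one being related only to itself. *)
pose r (x y : seq A) := (x == [::]) = (y == [::]) /\
  forall x' y' : free_semigroup A,
    val x' = x -> val y' = y -> generated_congruence R x' y'.
suff rP : word_congruence r.
  have rB : complete_upto g r B.
    move=> x y le_xB le_yB Exy; split=> [|x' y' Ex Ey].
      have ev0 := ev_eq1 (@adjoin1_mul_eq1 S) pow_inj.
      by apply/eqP/eqP => E; apply: ev0; [rewrite -Exy | rewrite Exy];
        rewrite E big_nil.
    rewrite -{}Ex -{}Ey in le_xB le_yB Exy.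
    move=> r' _ /(_ (x', y')); apply; rewrite mem_filter.
    by rewrite allpairs_f ?WP // andbT; apply/asboolP/e_inj.
  by have [_] := BP r rP rB _ _ uv; apply.
split; first split.
- by move=> x; split=> // x' y' <- /val_inj ->.
- move=> x y [xy gxy]; split=> [|x' y' Ex Ey]; first by rewrite xy.
  by apply: gs; apply: gxy.
- move=> x y z [xy gxy] [yz gyz]; split=> [|x' z' Ex Ez]; first by rewrite xy yz.
  have ny : y != [::] by rewrite -xy -Ex; exact: (valP x').
  by apply: (gt _ (Sub y ny)); [apply: gxy | apply: gyz].
move=> x x' y y' [xx' gx] [yy' gy]; split=> [|p p' Ep Ep'].
  have cat0 (w w' : seq A) : (w ++ w' == [::]) = (w == [::]) && (w' == [::]).
    by case: w w' => [|? ?] [|? ?].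
  by rewrite !cat0 xx' yy'.
have [x0|x0] := eqVneq x [::].
  apply: gy; rewrite ?Ep ?Ep' ?x0 //.
  by move: xx'; rewrite x0 eqxx => /esym/eqP ->.
have [y0|y0] := eqVneq y [::].
  apply: gx; rewrite ?Ep ?Ep' ?y0 ?cats0 //.
  by move: yy'; rewrite y0 eqxx => /esym/eqP ->; rewrite cats0.
have x0' : x' != [::] by rewrite -xx'.
have y0' : y' != [::] by rewrite -yy'.
pose word w (ne : w != [::]) : free_semigroup A := Sub w ne.
have -> : p = word x x0 * word y y0 by apply: val_inj.
have -> : p' = word x' x0' * word y' y0' by apply: val_inj.
by apply: gM; [apply: gx | apply: gy].
Qed.


End SemigroupUnion.

(** * Generators and unique powers from the decomposition *)

Local Open Scope classical_set_scope.

Theorem mainTheorem1 (S : semigroupType) (A : finType) (N : A -> set S)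
    (N_sub : forall a : A, subsemigroup (N a))
    (N_free_monogenic : forall a : A, free_monogenic (N a))
    (N_disjoint : trivIset [set: A] N)
    (N_cover : \bigcup_(a in [set: A]) N a = [set: S]) :
  finitely_presented S /\ residually_finite S.
Proof.
have /choice[f f_bij] := N_free_monogenic.
pose one : posnat := exist (fun n => 0 < n) 1%N isT.
pose g a : adjoin1 S := Some (f a one).
have gX a i (i_gt0 : 0 < i) :
    g a ^+ i = Some (f a (exist (fun n => 0 < n) i i_gt0)).
  case: i i_gt0 => // i; elim: i => [|i IH] i_gt0.
    by rewrite expg1; congr (Some (f a _)); apply: val_inj.
  rewrite expgS (IH isT) -[LHS]/(Some (_ * _)) -gmulfM.
  by congr (Some (f a _)); apply: val_inj.
have pow_ex (x : adjoin1 S) : x <> 1 -> exists a i, 0 < i /\ x = g a ^+ i.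
  case: x => [x _|[]//]; have : [set: S] x by [].
  rewrite -N_cover => -[a _ Nax]; have [_ _ f_surj] := f_bij a.
  by have [[i i_gt0] _ <-] := f_surj x Nax; exists a, i; rewrite gX.
have pow_inj a b i j : 0 < i -> g a ^+ i = g b ^+ j -> a = b /\ i = j.
  (* For [j = 0] the right side is the adjoined 1, which is not of the form [Some _]. *)
  move=> i_gt0; case: j => [|j]; rewrite (gX _ _ i_gt0) // (gX _ j.+1 isT) => -[E].
  have ab : a = b.
    apply: (N_disjoint a b I I); exists (f a (exist _ i i_gt0)); split.
      by have [fN _ _] := f_bij a; apply: fN.
    by rewrite E; have [fN _ _] := f_bij b; apply: fN.
  split=> //; rewrite -ab in E; have [_ f_inj _] := f_bij a.
  by have /(congr1 val) := f_inj _ _ (in_setT _) (in_setT _) E.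
split; first exact: union_finitely_presented pow_ex pow_inj.
exact: union_residually_finite pow_ex pow_inj.
Qed.
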